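(* Every subgroup of a B+E-group is also a B+E-group.
   Context: All groups are abelian. A group $G$ is Bassian if, for every subgroup $N$ of $G$, the existence of an injective homomorphism $G\to G/N$ implies that $N=\{0\}$. A torsion group $E$ is elementary if, for every prime $p$, its $p$-primary component $E_p$ satisfies $pE_p=0$. A group $G$ is a B+E-group if it decomposes as $G=A\oplus E$, where $A$ is Bassian and $E$ is elementary. *)

(* Defs.v *)
From HB Require Import structures.
From mathcomp Require Import all_boot all_order all_algebra.
Set Implicit Arguments.
Unset Strict Implicit.
Unset Printing Implicit Defensive.
Import GRing.Theory.
Local Open Scope ring_scope.

(* Abelian groups are zmodType's and subgroups are zmodClosed predicates.
   [subgroup H] is the subgroup H regarded as an abelian group in itself. *)
Definition subgroup (G : zmodType) (H : zmodClosed G) := {x : G | x \in H}.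

Section SubgroupZmodule.
Variables (G : zmodType) (H : zmodClosed G).
HB.instance Definition _ := SubChoice.on (subgroup H).
HB.instance Definition _ := [SubChoice_isSubZmodule of subgroup H by <:].
End SubgroupZmodule.

(* Despite its name, [{ideal_quot N}] is the quotient group G / N for any
   subgroup N of an abelian group G. *)
Definition Bassian (G : zmodType) : Prop :=
  forall N : zmodClosed G,
    (exists f : {additive G -> {ideal_quot N}}, injective f) ->
    forall x : G, x \in N -> x = 0.

Definition torsion (G : zmodType) : Prop :=
  forall x : G, exists n : nat, (0 < n)%N /\ x *+ n = 0.

Definition primary_component (G : zmodType) (p : nat) (x : G) : Prop :=
  exists k : nat, x *+ (p ^ k) = 0.

Definition elementary (E : zmodType) : Prop :=
  torsion E /\
  forall p : nat, prime p -> forall x : E, primary_component p x -> x *+ p = 0.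

Definition internal_direct_sum (G : zmodType) (A E : zmodClosed G) : Prop :=
  (forall x : G, exists a e : G, [/\ a \in A, e \in E & x = a + e]) /\
  (forall x : G, x \in A -> x \in E -> x = 0).

Definition BplusE_group (G : zmodType) : Prop :=
  exists A E : zmodClosed G,
    [/\ internal_direct_sum A E, Bassian (subgroup A) & elementary (subgroup E)].

(* Main.v *)
Require Import Defs.
From HB Require Import structures.
From mathcomp Require Import all_boot all_order all_algebra.
From mathcomp Require Import boolp classical_sets.
From mathcomp Require Import ring zify.

(** Write G = A + E with A Bassian and E elementary, and let H be a subgroup
    of G.  Every subgroup of an elementary group is a direct summand of it, so
    there is a retraction r of G onto the intersection of H and E that kills
    A ([elementary_retraction]).  Hence H is the direct sum of its part on
    which r vanishes and of its intersection with E.  The latter is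
    elementary; the former meets E trivially, so it embeds in A by the
    projection along E.  It remains to see that a group which embeds in a
    Bassian group is Bassian ([Bassian_inj]).

    For this, suppose that f : B -> B / N is injective and that N contains
    x <> 0.  Lift f to a map s : B -> B.  The orbit x, s x, s (s x), ... shows
    ([lift_dichotomy]) that B has infinite torsion-free rank or that some
    p-primary component of B is infinite: if x has infinite order the orbit is
    linearly independent, and otherwise x can be taken of prime order p and s
    can be chosen to preserve p-power torsion, so that the orbit is an infinite
    subset of the p-primary component.  Both properties pass to any group A
    that contains a copy of B, and each of them prevents A from being Bassian.

    The last point rests on [not_Bassian]: if two homomorphisms
    iota, phi : A -> L and a subgroup K of A are such that iota is injective on
    K, phi has a nonzero kernel on K, and every iota a - phi a lies in the image
    phi K, then A embeds in its quotient by the kernel of phi on K.  When L is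
    divisible, it is enough to define iota and phi on a subgroup, by
    [graph_extension].  The subgroup K and the group L are as follows.
    - Infinite rank: K is free of countable rank, and L is a countable sum of
      copies of the rationals, onto which K surjects with a nonzero kernel.
    - Infinite p-primary component T: look at the p-torsion of p^n A, for all n.
      If it is infinite for every n, then T contains a direct sum K of cyclic
      groups of orders p, p^2, p^3, ..., and L is a countable sum of Pruefer
      p-groups.  If it is infinite for n but finite for n + 1, then T contains
      a direct sum K of infinitely many cyclic groups of order p^(n+1) that
      meets p^(n+1) A trivially; iota and phi, with values in the same L, are
      then made to vanish on p^(n+1) A, which forces their values to be
      p^(n+1)-torsion.  If A has finite p-torsion, then T contains a nonzero
      divisible subgroup K = L, on which iota is the identity and phi is the
      multiplication by p. *)

Set Implicit Arguments.
Unset Strict Implicit.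
Unset Printing Implicit Defensive.
Import Order.TTheory GRing.Theory Num.Theory.
Local Open Scope ring_scope.
Local Open Scope quotient_scope.

(** * Subgroups and homomorphisms from propositional data *)

Lemma subrACA (V : zmodType) (x y z t : V) : x - y - (z - t) = x - z - (y - t).
Proof. by rewrite !opprD !opprK addrACA. Qed.

Section PropSubgroup.
Variables (G : zmodType) (P : G -> Prop).
Hypotheses (P0 : P 0) (PB : forall x y, P x -> P y -> P (x - y)).

Lemma prop_zmod_closed : zmod_closed (fun x : G => `[< P x >]).
Proof.
split; first exact/asboolP.
by move=> x y /asboolP hx /asboolP hy; apply/asboolP/PB.
Qed.

Definition prop_subgroup : zmodClosed G :=
  HB.pack (fun x : G => `[< P x >]) (GRing.isZmodClosed.Build G _ prop_zmod_closed).

Lemma prop_subgroupP x : reflect (P x) (x \in prop_subgroup).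
Proof. exact: asboolP. Qed.

End PropSubgroup.

Definition to_subgroup (G : zmodType) (H : zmodClosed G) x (Hx : x \in H) :
  subgroup H := exist _ x Hx.

Lemma val_to_subgroup (G : zmodType) (H : zmodClosed G) x (Hx : x \in H) :
  val (to_subgroup Hx) = x.
Proof. by []. Qed.

Definition additive_of (U V : zmodType) (f : U -> V) (fB : zmod_morphism f) :
    {additive U -> V} :=
  HB.pack f (GRing.isZmodMorphism.Build U V f fB).

(** * Extension of homomorphisms to a whole group *)

Section Extension.
Variables (A L : zmodType).

(** The graph of a homomorphism into [L] defined on some subgroup of [A].
    Encoding partial homomorphisms as sets makes their extension order the
    inclusion. *)
Definition additive_graph (R : set (A * L)) : Prop :=
  [/\ R (0, 0), forall u v, R u -> R v -> R (u - v)
    & forall l, R (0, l) -> l = 0].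

Section Graph.
Variable R : set (A * L).
Hypothesis Rg : additive_graph R.

Lemma graph0 : R (0, 0). Proof. by case: Rg. Qed.

Lemma graphB x y l l' : R (x, l) -> R (y, l') -> R (x - y, l - l').
Proof. by case: Rg => _ RB _ /RB /[apply]. Qed.

Lemma graphN x l : R (x, l) -> R (- x, - l).
Proof. by move/(graphB graph0); rewrite !sub0r. Qed.

Lemma graphD x y l l' : R (x, l) -> R (y, l') -> R (x + y, l + l').
Proof. by move=> xl /graphN /(graphB xl); rewrite !opprK. Qed.

Lemma graphMn x l n : R (x, l) -> R (x *+ n, l *+ n).
Proof.
move=> xl; elim: n => [|n IH]; first by rewrite !mulr0n; exact: graph0.
by rewrite !mulrS; apply: graphD.
Qed.

Lemma graphMz x l (k : int) : R (x, l) -> R (x *~ k, l *~ k).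
Proof.
case: k => n xl; first exact: graphMn.
by rewrite NegzE !mulrNz; apply/graphN/graphMn.
Qed.

Lemma graph_fun x l l' : R (x, l) -> R (x, l') -> l = l'.
Proof.
move=> xl /(graphB xl); case: Rg => _ _ R0; rewrite subrr => /R0 /eqP.
by rewrite subr_eq0 => /eqP.
Qed.

Definition graph_adjoin (x : A) (z : L) : set (A * L) :=
  [set u | exists k : int, R (u.1 - x *~ k, u.2 - z *~ k)].

(** A partial homomorphism extends to [x], with value [z], as soon as [z] is
    compatible with its values on the multiples of [x] in its domain. *)
Lemma graph_adjoinP x z :
  (forall (k : int) l, R (x *~ k, l) -> l = z *~ k) ->
  [/\ additive_graph (graph_adjoin x z), (R `<=` graph_adjoin x z)%classic
    & graph_adjoin x z (x, z)].
Proof.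
move=> xz; split.
- split.
  + by exists 0; rewrite /= !mulr0z !subr0; exact: graph0.
  + move=> [a l] [a' l'] [k /= h] [k' /= h']; exists (k - k'); rewrite /= !mulrzBr.
    by have := graphB h h'; congr R; congr (_, _); apply: subrACA.
  + move=> l [k /=]; rewrite sub0r => /graphN; rewrite opprK opprB => /xz.
    by move/eqP; rewrite subr_eq addrC -subr_eq subrr => /eqP.
- by move=> [a l] h; exists 0; rewrite /= !mulr0z !subr0.
- by exists 1; rewrite /= !mulr1z !subrr; exact: graph0.
Qed.

End Graph.

Lemma maximal_graph (R0 : set (A * L)) : additive_graph R0 ->
  exists2 R, additive_graph R /\ (R0 `<=` R)%classic &
    forall R', additive_graph R' -> (R `<=` R')%classic -> (R' `<=` R)%classic.
Proof.
move=> R0g.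
pose P (X : set (A * L)) := X = set0 \/ (additive_graph X /\ (R0 `<=` X)%classic).
have [F FP tot|R [PR Rmax]] := @Zorn_bigcup _ P.
  have [[X FX [Xg R0X]]|noX] := pselect (exists2 X, F X &
      additive_graph X /\ (R0 `<=` X)%classic); last first.
    left; apply/seteqP; split=> // u [X FX Xu].
    have [X0|?] := FP _ FX; first by rewrite X0 in Xu.
    by case: noX; exists X.
  have common u v : (\bigcup_(X in F) X)%classic u ->
      (\bigcup_(X in F) X)%classic v ->
      exists Y, [/\ F Y, additive_graph Y, Y u & Y v].
    move=> [Y FY Yu] [Z FZ Zv].
    have [YZ|ZY] := tot _ _ FY FZ.
      exists Z; split=> //; last exact: YZ.
      by case: (FP _ FZ) => [Z0|[]//]; rewrite Z0 in Zv.
    exists Y; split=> //; last exact: ZY.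
    by case: (FP _ FY) => [Y0|[]//]; rewrite Y0 in Yu.
  (* A union of a chain is a graph because any two of its elements lie in a
     common member; the empty set is in P only to cater for the empty chain. *)
  right; split; last by move=> u /R0X Xu; exists X.
  split.
  - by exists X => //; exact: graph0.
  - move=> u v hu hv; have [Y [FY [_ YB _] Yu Yv]] := common _ _ hu hv.
    by exists Y => //; exact: YB.
  - move=> l hl; have [Y [FY [_ _ Y0] Yl _]] := common _ _ hl hl.
    exact: Y0.
have [Rg R0R] : additive_graph R /\ (R0 `<=` R)%classic.
  case: PR => // R_0; exfalso; apply: (Rmax R0); last by right; split.
  rewrite R_0; split; first by move=> ? [].
  by move/(_ _ (graph0 R0g)).
exists R => // R' R'g RR'; have [//|nR'R] := pselect (R' `<=` R)%classic.
exfalso; apply: (Rmax R'); first by split.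
by right; split=> //; apply: subset_trans R0R RR'.
Qed.

(** Stripping the prime factors of [n] one at a time, some multiple of [x] is
    the last one outside [D]; this reduces extension problems to prime steps. *)
Lemma minimal_multiple (D : A -> Prop) n x :
  (0 < n)%N -> ~ D x -> D (x *+ n) ->
  exists p, exists y : nat, [/\ prime p, ~ D (x *+ y) & D (x *+ y *+ p)].
Proof.
elim/ltn_ind: n x => n IH x n0 nDx Dnx.
have n1 : (1 < n)%N by case: n n0 Dnx {IH} => [|[|n]] //.
have pp := pdiv_prime n1.
have [Dpx|nDpx] := pselect (D (x *+ pdiv n)).
  by exists (pdiv n), 1%N.
have [||||p [y [p_pr ny yp]]] := IH (n %/ pdiv n)%N _ (x *+ pdiv n).
- by rewrite ltn_Pdiv ?prime_gt1.
- by rewrite divn_gt0 ?pdiv_gt0 // pdiv_leq.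
- by [].
- by rewrite -mulrnA mulnC divnK ?pdiv_dvd.
by exists p, (pdiv n * y)%N; rewrite mulrnA.
Qed.

Lemma coprime_Bezout (p : nat) (k : int) : prime p -> ~~ (p %| k)%Z ->
  exists u v : int, u * p + v * k = 1.
Proof.
move=> pp npk; have : coprimez p k by rewrite coprimezE /= prime_coprime.
by move/coprimezP => [[u v] /= h]; exists u, v.
Qed.

(** Baer's argument.  A maximal extension is total: an element [x] outside its
    domain either has no nonzero multiple in the domain, and may be sent to [0],
    or may be chosen with [x *+ p] in the domain for a prime [p], and may be
    sent to any [p]-th part of the value at [x *+ p].  The divisibility is
    required only of the values of extensions of [R0], so that the lemma covers
    targets that are not divisible. *)
Lemma graph_extension (R0 : set (A * L)) : additive_graph R0 ->
  (forall R, additive_graph R -> (R0 `<=` R)%classic ->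
     forall p x l, prime p -> R (x *+ p, l) -> exists z, z *+ p = l) ->
  exists h : {additive A -> L}, forall x l, R0 (x, l) -> h x = l.
Proof.
move=> R0g step; have [R [Rg R0R] Rmax] := maximal_graph R0g.
pose D x := exists l, R (x, l).
have adjoin x z : (forall (k : int) l, R (x *~ k, l) -> l = z *~ k) -> D x.
  move=> /(graph_adjoinP Rg) [g sub xz]; exists z.
  exact: (Rmax _ g sub).
have tot x : D x.
  apply: contrapT => nDx.
  have [[n n0 Dn]|tf] := pselect (exists2 n, (0 < n)%N & D (x *+ n)).
    have [p [j [pp]]] := minimal_multiple n0 nDx Dn.
    move: (x *+ j) => y ny [l yl].
    have [z zl] := step R Rg R0R p _ l pp yl.
    apply: (ny); apply: (adjoin _ z) => k l' kl'.
    have [/dvdzP [q kq]|npk] := boolP (p %| k)%Z.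
      have := graphMz Rg q yl; rewrite -zl !pmulrn -!mulrzA.
      rewrite [p%:Z * q]mulrC -kq.
      exact: (graph_fun Rg kl').
    (* Otherwise y is a combination of its multiples by p and by k, which are
       in the domain. *)
    exfalso; apply: ny; have [u [v uv]] := coprime_Bezout pp npk.
    exists (l *~ u + l' *~ v).
    have := graphD Rg (graphMz Rg u yl) (graphMz Rg v kl').
    by rewrite pmulrn -!mulrzA -mulrzDr [p%:Z * u]mulrC [k * v]mulrC uv mulr1z.
  apply: nDx; apply: (adjoin _ 0) => k l kl.
  have k0 : k = 0.
    apply: contrapT => /eqP k0; apply: tf; exists `|k|%N; first by rewrite absz_gt0.
    exists (l *~ sgz k); have := graphMz Rg (sgz k) kl.
    by rewrite -mulrzA mulrC -abszEsg.
  move: kl; rewrite k0 !mulr0z => kl; exact: (graph_fun Rg kl (graph0 Rg)).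
have [h hR] := choice tot.
have hB : zmod_morphism h.
  by move=> x y; apply: (graph_fun Rg (hR _)); apply: graphB.
by exists (additive_of hB) => x l /R0R; apply: (graph_fun Rg (hR x)).
Qed.

End Extension.

(** * A criterion for not being Bassian *)

(** A wrapper around the quotient map that keeps its additive structure visible
    after simplification. *)
Definition proj (G : zmodType) (N : zmodClosed G) : {additive G -> {ideal_quot N}} :=
  \pi_({ideal_quot N}).
Arguments proj : simpl never.

Lemma proj_eq (G : zmodType) (N : zmodClosed G) (x y : G) :
  (proj N x == proj N y) = (x - y \in N).
Proof. by rewrite Quotient.idealrBE. Qed.

Lemma proj_eq0 (G : zmodType) (N : zmodClosed G) (x : G) :
  (proj N x == 0) = (x \in N).
Proof. by rewrite -(raddf0 (proj N)) proj_eq subr0. Qed.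

Lemma proj_repr (G : zmodType) (N : zmodClosed G) (z : {ideal_quot N}) :
  proj N (repr z) = z.
Proof. exact: reprK. Qed.

(** Let [N] be the kernel of [phi] on [K].  The pair formed by [phi] and the
    projection to A / K identifies A / N with a subgroup of L x A / K; the
    second hypothesis says that this subgroup contains every (iota a, a + K).
    So [a] can be sent to the class of some [b] with [b - a] in [K] and
    phi b = iota a, and this embeds A in A / N because [iota] is injective on
    [K]. *)
Lemma not_Bassian (A L : zmodType) (K : zmodClosed A) (iota phi : {additive A -> L}) :
  (forall x, x \in K -> iota x = 0 -> x = 0) ->
  (forall a, exists2 k, k \in K & phi k = iota a - phi a) ->
  (exists x, [/\ x \in K, phi x = 0 & x <> 0]) ->
  ~ Bassian A.
Proof.
move=> iota_inj surj [x0 [Kx0 phix0 x0N0]] BA.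
pose P x := x \in K /\ phi x = 0.
have P0 : P 0 by split; rewrite ?rpred0 ?raddf0.
have PB x y : P x -> P y -> P (x - y).
  by move=> [Kx px] [Ky py]; split; rewrite ?rpredB // raddfB px py subrr.
pose N := prop_subgroup P0 PB.
apply/x0N0/(BA N); last exact/prop_subgroupP.
have /choice [g gP] : forall a, exists b,
    proj K b = proj K a /\ phi b = iota a.
  move=> a; have [k Kk phik] := surj a.
  exists (k + a); split; last by rewrite raddfD phik subrK.
  by apply/eqP; rewrite proj_eq addrK.
pose f a := proj N (g a).
have fB : zmod_morphism f.
  move=> a b; rewrite /f -raddfB; apply/eqP; rewrite proj_eq; apply/prop_subgroupP.
  have [ga pa] := gP a; have [gb pb] := gP b; have [gab pab] := gP (a - b).
  split; last by rewrite 2!(raddfB phi) pab pa pb (raddfB iota) subrr.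
  by rewrite -proj_eq !raddfB /= gab ga gb raddfB.
exists (additive_of fB) => a b /= /eqP; rewrite proj_eq => /prop_subgroupP [Kg pg].
have [ga pa] := gP a; have [gb pb] := gP b.
apply/eqP; rewrite -subr_eq0; apply/eqP/iota_inj; last first.
  by rewrite raddfB -pa -pb -raddfB.
by rewrite -proj_eq -ga -gb proj_eq.
Qed.

(** * Linear combinations of sequences *)

(** Polynomials over the integers serve as the free abelian group of countable
    rank: [lincomb y] is the homomorphism that sends ['X^i] to [y i]. *)
Definition lincomb (V : zmodType) (y : nat -> V) (c : {poly int}) : V :=
  \sum_(i < size c) y i *~ c`_i.

Lemma lincomb_wide (V : zmodType) (y : nat -> V) (c : {poly int}) n :
  (size c <= n)%N -> lincomb y c = \sum_(i < n) y i *~ c`_i.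
Proof.
move=> cn; rewrite /lincomb (big_ord_widen n (fun i => y i *~ c`_i)) //.
rewrite [LHS]big_mkcond; apply: eq_bigr => i _.
by case: ltnP => // /(nth_default 0) ->; rewrite mulr0z.
Qed.

Lemma lincombB (V : zmodType) (y : nat -> V) : zmod_morphism (lincomb y).
Proof.
move=> c d; pose n := maxn (size (c - d)) (maxn (size c) (size d)).
rewrite !(@lincomb_wide _ y _ n) ?leq_max ?leqnn ?orbT // -sumrB.
by apply: eq_bigr => i _; rewrite coefB mulrzBr.
Qed.

HB.instance Definition _ (V : zmodType) (y : nat -> V) :=
  GRing.isZmodMorphism.Build {poly int} V (lincomb y) (lincombB y).

Lemma lincombXn (V : zmodType) (y : nat -> V) i : lincomb y 'X^i = y i.
Proof.
rewrite (@lincomb_wide _ y _ i.+1) ?size_polyXn // big_ord_recr /=.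
rewrite coefXn eqxx mulr1z big1 ?add0r // => j _.
by rewrite coefXn ltn_eqF // mulr0z.
Qed.

Lemma lincomb_comp (U V : zmodType) (f : {additive U -> V}) y c :
  f (lincomb y c) = lincomb (f \o y) c.
Proof. by rewrite raddf_sum; apply: eq_bigr => i _; rewrite raddfMz. Qed.

(** * Orbits of a lifted embedding into a quotient *)

Definition independent_seq (V : zmodType) (y : nat -> V) : Prop :=
  forall c, lincomb y c = 0 -> c = 0.

Definition p_power_torsion_seq (V : zmodType) (p : nat) (y : nat -> V) : Prop :=
  injective y /\ forall i, primary_component p (y i).

(** Multiplication by [u] is invertible on torsion of order prime to [u]. *)
Lemma mulrz_coprime_inv (V : zmodType) (q : nat) (u : nat) (x : V) :
  coprime u q -> x *+ q = 0 -> exists v : int, x *~ v *+ u = x.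
Proof.
move=> uq xq; have : coprimez u q by rewrite coprimezE.
move/coprimezP => [[v w] /= vw]; exists v.
rewrite pmulrn -mulrzA; have := congr1 (fun k => x *~ k) vw.
by rewrite /= mulrzDr [w * _]mulrC [X in _ + X]mulrzA -pmulrn xq mul0rz addr0 mulr1z.
Qed.

Lemma primary_split (p n : nat) : prime p -> (0 < n)%N ->
  exists a u, n = (u * p ^ a)%N /\ coprime u p.
Proof.
move=> pp n0; have [u pu ->] := pfactor_coprime pp n0; exists (logn p n), u.
by rewrite coprime_sym.
Qed.

Section Lift.
Variables (B : zmodType) (N : zmodClosed B) (f : {additive B -> {ideal_quot N}}).
Hypothesis f_inj : injective f.

Let f_eq0 x : f x = 0 -> x = 0.
Proof. by rewrite -[RHS](raddf0 f) => /f_inj. Qed.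

(** Modulo [N] the term at [x] of a relation disappears, and the other terms
    become the image under [f] of a shorter relation, which is trivial by
    induction.  What is left is a multiple of [x]. *)
Lemma lift_orbit_independent s x : (forall b, proj N (s b) = f b) ->
  x \in N -> (forall n, (0 < n)%N -> x *+ n <> 0) ->
  independent_seq (fun i => iter i s x).
Proof.
move=> sP Nx xfree c c0; apply/polyP => i; rewrite coef0.
have [ci|/(nth_default 0)//] := ltnP i (size c).
move: c0; rewrite /lincomb; move: (size c) (nth 0 c) i ci => {c}.
elim=> // n IH c i ci; rewrite big_ord_recl /= => c0.
have cS j : (j < n)%N -> c j.+1 = 0.
  move=> jn; apply: (IH (fun j => c j.+1) j jn); apply: f_eq0.
  have /eqP := congr1 (proj N) c0; rewrite raddfD raddf0 /= raddfMz.
  have /eqP pix : proj N x == 0 by rewrite proj_eq0. rewrite pix.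
  rewrite mul0rz add0r !raddf_sum => /eqP e; rewrite -[RHS]e; apply: eq_bigr => k _.
  by rewrite !raddfMz /= sP.
case: i ci => [_|i]; last exact: cS.
move: c0; rewrite big1 ?addr0 => [c0|j _]; last by rewrite cS // mulr0z.
apply: contrapT => /eqP; rewrite -absz_gt0 => /xfree; apply.
have := congr1 (fun z => z *~ sgz (c 0%N)) c0.
by rewrite mul0rz -mulrzA mulrC -abszEsg.
Qed.

(** A lift [y0] of [f x] is torsion because [N] is.  A suitable multiple of the
    prime-to-[p] part of its order acts as the identity on [f x], and
    multiplication by it leaves only [p]-power torsion in [y0]. *)
Lemma lift_primary p x : prime p ->
  (forall z, z \in N -> exists2 n, (0 < n)%N & z *+ n = 0) -> primary_component p x ->
  exists2 y, primary_component p y & proj N y = f x.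
Proof.
move=> pp Ntors [k xk]; pose y0 := repr (f x).
have piy0 : proj N y0 = f x by rewrite proj_repr.
have Ny0 : y0 *+ p ^ k \in N.
  by rewrite -proj_eq0 raddfMn /= piy0 -raddfMn xk raddf0.
have [n n0 yn] := Ntors _ Ny0.
have [a [u [na up]]] := primary_split pp n0.
have [||v vu] := @mulrz_coprime_inv _ (p ^ k) u (f x).
- by rewrite coprimeXr.
- by rewrite -(raddfMn f) xk (raddf0 f).
exists (y0 *~ v *+ u); last by rewrite raddfMn raddfMz /= piy0.
exists (k + a)%N.
have -> : y0 *~ v *+ u *+ p ^ (k + a) = y0 *+ p ^ k *+ (u * p ^ a) *~ v.
  by rewrite !pmulrn -!mulrzA; congr (_ *~ _); rewrite expnD; lia.
by rewrite -na yn mul0rz.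
Qed.

(** A coincidence in the orbit can be pulled back along [f] until it involves
    [x] itself, which is [0] modulo [N], while no later term is. *)
Lemma lift_orbit_injective s x :
  (forall i, proj N (s (iter i s x)) = f (iter i s x)) -> x \in N -> x <> 0 ->
  injective (fun i => iter i s x).
Proof.
move=> sP Nx x0.
have xN0 j : iter j s x <> 0.
  elim: j => // j IH jx; apply/IH/f_eq0; rewrite -sP -iterS jx.
  exact: (raddf0 (proj N)).
have piS j : proj N (iter j.+1 s x) <> 0 by rewrite iterS sP => /f_eq0 /xN0.
have pix : proj N x = 0 by apply/eqP; rewrite proj_eq0.
elim=> [|i IH] [|j] //= e.
- by case: (piS j); rewrite /= -e.
- by case: (piS i); rewrite /= e.
- by congr _.+1; apply/IH/f_inj; rewrite -!sP e.
Qed.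

Lemma lift_dichotomy x : x \in N -> x <> 0 ->
  (exists y : nat -> B, independent_seq y) \/
  exists p (y : nat -> B), prime p /\ p_power_torsion_seq p y.
Proof.
move=> Nx xN0.
have [[z Nz zfree]|nfree] := pselect (exists2 z, z \in N &
    forall n, (0 < n)%N -> z *+ n <> 0).
  left; exists (fun i => iter i (fun b => repr (f b)) z).
  by apply: lift_orbit_independent => // b; rewrite proj_repr.
right; have Ntors z : z \in N -> exists2 n, (0 < n)%N & z *+ n = 0.
  move=> Nz; apply: contrapT => ztors; apply: nfree; exists z => // n n0 zn.
  by apply: ztors; exists n.
have [n n0 xn] := Ntors x Nx.
have [p [j [pp xj xjp]]] := @minimal_multiple B (fun z => z = 0) n x n0 xN0 xn.
have /choice [s sP] : forall b, exists y, primary_component p b ->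
    primary_component p y /\ proj N y = f b.
  move=> b; have [bp|nbp] := pselect (primary_component p b); last by exists 0.
  by have [y yp piy] := lift_primary pp Ntors bp; exists y.
have orb i : primary_component p (iter i s (x *+ j)).
  elim: i => [|i /sP[]] //; by exists 1%N; rewrite expn1.
exists p, (fun i => iter i s (x *+ j)); split=> //; split=> //.
apply: lift_orbit_injective => // [i|]; first by case: (sP _ (orb i)).
by rewrite rpredMn.
Qed.

End Lift.

(** * Groups with a large independent family *)

Definition divisible (L : zmodType) : Prop :=
  forall p (l : L), prime p -> exists z, z *+ p = l.

(** The sequence [y] generates a direct sum of cyclic groups of orders [o i],
    with [o i = 0] for an infinite one, and this sum meets m A trivially. *)
Section Family.
Variables (A L : zmodType) (m : nat) (y : nat -> A) (o : nat -> nat).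
Hypothesis L_div : divisible L.
Hypothesis y_tors : forall i, y i *+ o i = 0.
Hypothesis y_indep : forall c a, lincomb y c = a *+ m -> forall i, (o i %| c`_i)%Z.

Lemma lincomb_eq0 (V : zmodType) (t : nat -> V) (c : {poly int}) :
  (forall i, t i *+ o i = 0) -> (forall i, (o i %| c`_i)%Z) -> lincomb t c = 0.
Proof.
move=> to oc; apply: big1 => i _; have /dvdzP [q ->] := oc i.
by rewrite mulrC mulrzA -pmulrn to mul0rz.
Qed.

(** Killing the multiples of [m] makes the values of [h] be [m]-torsion. *)
Lemma family_extension (t : nat -> L) : (forall i, t i *+ o i = 0) ->
  exists h : {additive A -> L}, (forall i, h (y i) = t i) /\ forall a, h (a *+ m) = 0.
Proof.
move=> to.
pose R0 : set (A * L) := fun u => exists c a,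
  u.1 = lincomb y c + a *+ m /\ u.2 = lincomb t c.
have R0g : additive_graph R0.
  split.
  - by exists 0, 0; rewrite /= mul0rn addr0 !raddf0.
  - move=> [x l] [x' l'] [c [a /= [-> ->]]] [c' [a' /= [-> ->]]]; exists (c - c'), (a - a').
    by rewrite /= !raddfB mulrnBl addrACA opprD.
  - move=> l [c [a /= [/esym/eqP]]]; rewrite addr_eq0 -mulNrn => /eqP /y_indep oc ->.
    exact: lincomb_eq0.
have [|h hR] := graph_extension R0g; first by move=> *; exact: L_div.
exists h; split=> [i|a].
  by apply: hR; exists 'X^i, 0; rewrite /= !lincombXn mul0rn addr0.
by apply: hR; exists 0, a; rewrite /= !raddf0 add0r.
Qed.

(** The independent family [b] gives the injection [iota], and the sequence [e],
    which takes every value infinitely often, gives the surjection [phi]: any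
    [m]-torsion [l] occurs as [e i] for some [i] with [l *+ o i = 0], so that
    [y i] may be sent to [l]. *)
Lemma family_not_Bassian (b e : nat -> L) :
  (forall i, b i *+ o i = 0) ->
  (forall c, lincomb b c = 0 -> forall i, (o i %| c`_i)%Z) ->
  (forall (l : L) M, exists2 i, (M <= i)%N & e i = l) ->
  (forall l : L, l *+ m = 0 -> exists M, forall i, (M <= i)%N -> l *+ o i = 0) ->
  o 0%N <> 1%N ->
  ~ Bassian A.
Proof.
move=> bo bindep esurj mo o0.
(* The index 0 is set aside so that y 0 is a nonzero element of the kernel. *)
pose t i := if (0 < i)%N && (e i *+ o i == 0) then e i else 0.
have to i : t i *+ o i = 0.
  by rewrite /t; case: ifP => [/andP [_ /eqP]|]; rewrite ?mul0rn.
have [iota [iotay iotam]] := family_extension bo.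
have [phi [phiy phim]] := family_extension to.
pose P x := exists c, x = lincomb y c.
have P0 : P 0 by exists 0; rewrite raddf0.
have PB x z : P x -> P z -> P (x - z).
  by move=> [c ->] [d ->]; exists (c - d); rewrite raddfB.
apply: (@not_Bassian A L (prop_subgroup P0 PB) iota phi).
- move=> x /prop_subgroupP [c ->]; rewrite lincomb_comp => hc.
  apply: lincomb_eq0 => //; apply: bindep; rewrite -[RHS]hc.
  by apply: eq_bigr => i _; rewrite /= iotay.
- move=> a; set l := iota a - phi a.
  have lm : l *+ m = 0 by rewrite mulrnBl -!raddfMn iotam phim subrr.
  have [M oM] := mo l lm; have [i Mi ei] := esurj l M.+1.
  exists (y i); first by apply/prop_subgroupP; exists 'X^i; rewrite lincombXn.
  by rewrite phiy /t ei oM ?eqxx ?andbT ?(leq_trans _ Mi) // ltnW.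
- exists (y 0%N); split.
  + by apply/prop_subgroupP; exists 'X^0; rewrite lincombXn.
  + by rewrite phiy.
  + move=> y0; apply: o0; have := @y_indep 'X^0 0.
    rewrite lincombXn y0 mul0rn => /(_ erefl 0%N).
    by rewrite coefXn /= dvdz1 => /eqP.
Qed.

End Family.

Lemma enumerate_infinitely_often (T : countType) (L : zmodType) (q : T -> L) :
  (forall l, exists t, q t = l) ->
  exists e : nat -> L, forall l M, exists2 i, (M <= i)%N & e i = l.
Proof.
move=> qsurj.
(* Every i.+1 is 2 ^ a * M.*2.+1 in exactly one way: a is the code of the value
   and M numbers its occurrences. *)
exists (fun i => if unpickle (logn 2 i.+1) is Some t then q t else 0) => l M.
have [t qt] := qsurj l.
have n0 : (0 < 2 ^ pickle t * M.*2.+1)%N by rewrite muln_gt0 expn_gt0.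
exists (2 ^ pickle t * M.*2.+1).-1.
  have : (M.*2.+1 <= 2 ^ pickle t * M.*2.+1)%N by rewrite leq_pmull // expn_gt0.
  lia.
rewrite prednK // lognM // ?expn_gt0 // lognX logn_prime // eqxx muln1.
have -> : logn 2 M.*2.+1 = 0%N.
  by apply/eqP; rewrite -leqn0 leqNgt logn_gt0 mem_primes /= dvdn2 /= odd_double.
by rewrite addn0 pickleK.
Qed.

Lemma coef_lincomb_monomials (a : nat -> rat) (c : {poly int}) j :
  (lincomb (fun i => a i *: 'X^i) c)`_j = a j *~ c`_j.
Proof.
have [n [cn jn]] : exists n, (size c <= n)%N /\ (j < n)%N.
  by exists (maxn (size c) j.+1); rewrite leq_max leqnn leq_maxr.
rewrite (lincomb_wide _ cn) coef_sum (bigD1 (Ordinal jn)) //= big1 ?addr0.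
  by rewrite scalerMzl coefZ coefXn eqxx mulr1.
move=> i; rewrite -val_eqE /= => ij.
by rewrite scalerMzl coefZ coefXn eq_sym (negPf ij) mulr0.
Qed.

Lemma divisible_poly_rat : divisible {poly rat}.
Proof.
move=> p l pp; exists (p%:R^-1 *: l).
by rewrite -scaler_nat scalerA divff ?scale1r // pnatr_eq0 -lt0n prime_gt0.
Qed.

Lemma infinite_rank_not_Bassian (A : zmodType) (y : nat -> A) :
  independent_seq y -> ~ Bassian A.
Proof.
move=> yind.
have [e eP] := @enumerate_infinitely_often {poly rat} {poly rat} id
  (fun l => ex_intro _ l erefl).
apply: (@family_not_Bassian A {poly rat} 0 y (fun=> 0%N) divisible_poly_rat _ _
  (fun i => 1 *: 'X^i) e) => // [c a|c c0 i|l _].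
- by rewrite mulr0n => /yind -> i; rewrite coef0.
- have := congr1 (fun f : {poly rat} => f`_i) c0.
  rewrite coef_lincomb_monomials coef0 => /eqP; rewrite intr_eq0 => /eqP ->.
  by rewrite dvdz0.
- by exists 0%N.
Qed.

Section PLocal.
Variable p : nat.
Hypothesis pp : prime p.

(** The coefficients lie in the localization of the integers at [p]; a common
    denominator [u] suffices, as there are finitely many of them. *)
Definition p_integral (f : {poly rat}) : Prop :=
  exists2 u : nat, coprime u p & forall i, exists k : int, f`_i *+ u = k%:~R.

Lemma p_integral0 : p_integral 0.
Proof. by exists 1%N; rewrite ?coprime1n // => i; exists 0; rewrite coef0. Qed.

Lemma p_integralB f g : p_integral f -> p_integral g -> p_integral (f - g).
Proof.
move=> [u up fu] [v vp gv]; exists (u * v)%N; first by rewrite coprimeMl up.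
move=> i; have [[k fk] [l gl]] := (fu i, gv i); exists (k * v - l * u).
by rewrite coefB mulrnBl mulrnA fk mulnC mulrnA gl intrB !intrM !pmulrn !mulrzr.
Qed.

Definition p_integral_polys : zmodClosed {poly rat} :=
  prop_subgroup p_integral0 p_integralB.

(** Coefficientwise, the rationals modulo the [p]-local integers form the
    Pruefer [p]-group; polynomials give a countable direct sum of copies. *)
Definition prufer_sum : zmodType := {ideal_quot p_integral_polys}.

Lemma divisible_prufer_sum : divisible prufer_sum.
Proof.
move=> q l qp; have [z zl] := divisible_poly_rat (repr l) qp.
by exists (proj p_integral_polys z); rewrite -raddfMn zl proj_repr.
Qed.

Lemma prufer_sum_torsion (l : prufer_sum) : primary_component p l.
Proof.
(* A power of p clears the denominators up to a factor prime to p. *)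
pose z := repr l; pose d := (\prod_(i < size z) `|denq z`_i|)%N.
have d0 : (0 < d)%N by apply: prodn_gt0 => i; rewrite absz_gt0 denq_neq0.
have [a [u [da up]]] := primary_split pp d0.
exists a; rewrite -[l]proj_repr -raddfMn; apply/eqP; rewrite proj_eq0.
apply/prop_subgroupP; exists u => // i; rewrite coefMn -mulrnA mulnC -da.
have [iz|/(nth_default 0) ->] := ltnP i (size z); last by exists 0; rewrite mul0rn.
rewrite /d (bigD1 (Ordinal iz)) //= mulrnA.
set r := (\prod_(_ < _ | _) _)%N; exists (numq z`_i * r).
rewrite intrM -mulr_natr; congr (_ * _).
by rewrite numqE -mulr_natr natr_absz gtr0_norm ?denq_gt0.
Qed.

Lemma prufer_sum_independent (k : nat -> nat) (c : {poly int}) :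
  lincomb (fun i => proj p_integral_polys ((p ^ k i)%N%:R^-1 *: 'X^i)) c = 0 ->
  forall i, ((p ^ k i)%N %| c`_i)%Z.
Proof.
move=> c0 i.
have : proj p_integral_polys (lincomb (fun i => (p ^ k i)%N%:R^-1 *: 'X^i) c) = 0.
  by rewrite lincomb_comp.
move/eqP; rewrite proj_eq0 => /prop_subgroupP [u up /(_ i) [l]].
rewrite coef_lincomb_monomials => e.
have q0 : (p ^ k i)%N%:R != 0 :> rat by rewrite pnatr_eq0 -lt0n expn_gt0 prime_gt0.
have cu : c`_i * u = l * (p ^ k i)%N.
  apply: (@intr_inj rat); rewrite !intrM -e -mulrzr -mulr_natr.
  by rewrite -!pmulrn; field.
rewrite -(@Gauss_dvdzl _ _ u); last by rewrite coprimezE /= coprime_sym coprimeXr.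
by rewrite cu dvdz_mull.
Qed.

Lemma family_prufer_not_Bassian (A : zmodType) (m : nat) (y : nat -> A) (k : nat -> nat) :
  (forall i, y i *+ p ^ (k i).+1 = 0) ->
  (forall c a, lincomb y c = a *+ m -> forall i, ((p ^ (k i).+1)%N %| c`_i)%Z) ->
  (forall l : prufer_sum, l *+ m = 0 ->
     exists M, forall i, (M <= i)%N -> l *+ p ^ (k i).+1 = 0) ->
  ~ Bassian A.
Proof.
move=> yo yind mk.
have [e eP] := @enumerate_infinitely_often {poly rat} prufer_sum
  (proj p_integral_polys) (fun l => ex_intro _ (repr l) (proj_repr l)).
apply: (@family_not_Bassian A prufer_sum m y (fun i => p ^ (k i).+1)%N
  divisible_prufer_sum yo yind
  (fun i => proj p_integral_polys ((p ^ (k i).+1)%N%:R^-1 *: 'X^i)) e _ _ eP mk).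
- move=> i; apply/eqP; rewrite -raddfMn proj_eq0; apply/prop_subgroupP.
  exists 1%N; first exact: coprime1n.
  move=> j; exists (i == j)%:Z; rewrite coefMn coefZ coefXn.
  rewrite mulr1n -[LHS]mulr_natr mulrAC mulVf ?mul1r 1?[j == i]eq_sym ?pmulrn //.
  by rewrite -pmulrn pnatr_eq0 -lt0n expn_gt0 prime_gt0.
- exact: (@prufer_sum_independent (fun i => (k i).+1)).
- have := prime_gt1 pp; rewrite -(@ltn_exp2r 1 p (k 0%N).+1) // exp1n.
  by move=> /ltn_eqF /eqP /nesym.
Qed.

End PLocal.

(** * Infinite primary components *)

Definition finite_pred (T : eqType) (P : T -> Prop) : Prop :=
  exists s : seq T, forall x, P x -> x \in s.

Lemma infinite_pick (T : eqType) (P : T -> Prop) (s : seq T) :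
  ~ finite_pred P -> exists2 x, P x & x \notin s.
Proof.
move=> infP; apply: contrapT => none; apply: infP; exists s => x Px.
by apply: contrapT => /negP xs; apply: none; exists x.
Qed.

Lemma injective_infinite (T : eqType) (P : T -> Prop) (y : nat -> T) :
  injective y -> (forall i, P (y i)) -> ~ finite_pred P.
Proof.
move=> yinj Py [s sP].
have : (size (map y (iota 0 (size s).+1)) <= size s)%N.
  apply: uniq_leq_size; first by rewrite map_inj_uniq ?iota_uniq.
  by move=> _ /mapP [i _ ->]; apply: sP.
by rewrite size_map size_iota ltnn.
Qed.

(** Compactness: a decreasing sequence of nonempty subsets of a finite set has a
    common element. *)
Lemma finite_decreasing (T : eqType) (s : seq T) (Q : nat -> T -> Prop) :
  (forall n x, Q n.+1 x -> Q n x) -> (forall n, exists2 x, x \in s & Q n x) ->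
  exists2 x, x \in s & forall n, Q n x.
Proof.
move=> Qdec Qs; apply: contrapT => none.
have Qle m n x : (m <= n)%N -> Q n x -> Q m x.
  by move/subnK <-; elim: (n - m)%N => // d IH; rewrite addSn => /Qdec.
have /choice [g gP] : forall x, exists n, x \in s -> ~ Q n x.
  move=> x; have [xs|_] := boolP (x \in s); last by exists 0%N.
  apply: contrapT => all; apply: none; exists x => // n.
  by apply: contrapT => nQ; apply: all; exists n.
have [x xs Qx] := Qs (\max_(z <- s) g z)%N.
by apply: (gP x xs); apply: Qle Qx; apply: leq_bigmax_seq.
Qed.

Lemma mulrz_suml (V : zmodType) n (F : 'I_n -> V) (k : int) :
  (\sum_(i < n) F i) *~ k = \sum_(i < n) F i *~ k.
Proof.
by apply: (big_morph (fun x => x *~ k)) => [x y|]; rewrite ?mulrzDl ?mul0rz.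
Qed.

Lemma socle_multiple (V : zmodType) (p l : nat) (x : V) : x <> 0 -> x *+ p ^ l = 0 ->
  exists j, x *+ p ^ j <> 0 /\ x *+ p ^ j *+ p = 0.
Proof.
move=> x0; elim: l => [|l IH]; first by rewrite mulr1n.
rewrite expnSr mulrnA => xl; have [/IH//|xl0] := pselect (x *+ p ^ l = 0).
by exists l.
Qed.

Lemma not_dvd_primary (V : zmodType) (p q : nat) (x : V) :
  prime p -> prime q -> primary_component p x -> q <> p ->
  exists v : int, x *~ v *+ q = x.
Proof.
move=> pp pq [k xk] qp; apply: mulrz_coprime_inv xk.
by rewrite coprimeXr // prime_coprime // dvdn_prime2 //; apply/eqP.
Qed.

Section PrimaryPart.
Variables (A : zmodType) (p : nat).
Hypothesis pp : prime p.

Let p0 : (p : int) != 0.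
Proof. by have := prime_gt0 pp; case: (p). Qed.

Definition p_socle_of_multiples (n : nat) (z : A) : Prop :=
  z *+ p = 0 /\ exists a, z = a *+ n.

Lemma p_socle_of_multiplesMz n z (v : int) :
  p_socle_of_multiples n z -> p_socle_of_multiples n (z *~ v).
Proof.
move=> [zp [a za]]; split; last by exists (a *~ v); rewrite za !pmulrn -!mulrzA mulrC.
by rewrite pmulrn -mulrzA mulrC mulrzA -pmulrn zp mul0rz.
Qed.

(** Elements [y i] of order p^(k i + 1) are chosen one after the other, each
    time with [y i *+ p ^ k i] outside the finite subgroup spanned by the
    previous ones and the [p]-torsion of m A. *)
Section Greedy.
Variables (m : nat) (k : nat -> nat).
Hypothesis fin_m : finite_pred (p_socle_of_multiples m).
Hypothesis inf_k : forall i, ~ finite_pred (p_socle_of_multiples (p ^ k i)).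

Lemma greedy_socle : exists y : nat -> A,
  (forall i, y i *+ p ^ (k i).+1 = 0) /\
  forall n (d : nat -> int),
    p_socle_of_multiples m (\sum_(i < n) y i *+ p ^ k i *~ d i) ->
    forall i, (i < n)%N -> (p %| d i)%Z.
Proof.
have [s sP] := fin_m.
have /choice [g gP] : forall iW : nat * seq A, exists y,
    y *+ p ^ (k iW.1).+1 = 0 /\ y *+ p ^ k iW.1 \notin iW.2.
  move=> [i W]; have [x [xp [y xy]] xW] := infinite_pick W (inf_k (i := i)).
  by exists y; rewrite expnSr mulrnA -xy.
(* W n lists the [p]-torsion of m A and the combinations of the first n
   choices; coefficients below p are enough, since p kills everything. *)
pose W := fix W n := if n is i.+1 then
  [seq w + g (i, W i) *+ p ^ k i *+ j | w <- W i, j <- iota 0 p] else s.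
pose y i := g (i, W i); pose x i := y i *+ p ^ k i.
have xp i : x i *+ p = 0.
  by rewrite -mulrnA -expnSr; have [] := gP (i, W i).
have xW i : x i \notin W i by have [] := gP (i, W i).
have inW n (d : nat -> int) z : p_socle_of_multiples m z ->
    z + \sum_(i < n) x i *~ d i \in W n.
  move=> zm; elim: n => [|n IH]; first by rewrite big_ord0 addr0; exact: sP.
  rewrite big_ord_recr /= addrA.
  have -> : x n *~ d n = x n *+ `|(d n %% p)%Z|%N.
    rewrite {1}(divz_eq (d n) p) mulrzDr mulrC mulrzA -pmulrn xp mul0rz add0r.
    by rewrite pmulrn gez0_abs // modz_ge0.
  apply/allpairsP; exists (z + \sum_(i < n) x i *~ d i, `|(d n %% p)%Z|%N).
  split=> //=; rewrite mem_iota /= add0n -ltz_nat gez0_abs ?modz_ge0 //.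
  by rewrite ltz_pmod // ltz_nat prime_gt0.
exists y; split=> [i|]; first by have [] := gP (i, W i).
elim=> // n IH d; rewrite big_ord_recr /= => hd.
(* Were the last coefficient invertible modulo p, the last x n would be a
   combination of the previous ones. *)
have dn : (p %| d n)%Z.
  apply: contrapT => /negP /(coprime_Bezout pp) [u [v uv]].
  have /negP := xW n; apply.
  have -> : x n = (\sum_(i < n) x i *~ d i + x n *~ d n) *~ v +
      \sum_(i < n) x i *~ (- (d i * v)).
    under [X in _ + X]eq_bigr do rewrite mulrNz mulrzA.
    rewrite sumrN -mulrz_suml mulrzDl addrAC subrr add0r -mulrzA.
    have xu : x n *~ (u * p) = 0 by rewrite mulrC mulrzA -pmulrn xp mul0rz.
    by rewrite -[LHS]mulr1z -uv mulrzDr xu add0r mulrC.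
  apply: (inW n (fun i => - (d i * v))); exact: p_socle_of_multiplesMz.
move=> i; rewrite ltnS leq_eqVlt => /predU1P [->//|]; apply: IH.
move: hd; rewrite -/(x n); have /dvdzP [q ->] := dn.
by rewrite mulrC mulrzA -pmulrn xp mul0rz addr0.
Qed.

(** From the socle to the whole sum: if the coefficients are divisible by the
    orders after multiplication by p^(t+1), then p^t times the relation is a
    relation between the socle elements, so that p^t suffices; descend to
    [t = 0]. *)
Lemma greedy_family : exists y : nat -> A,
  (forall i, y i *+ p ^ (k i).+1 = 0) /\
  forall c a, lincomb y c = a *+ m -> forall i, ((p ^ (k i).+1)%N %| c`_i)%Z.
Proof.
have [y [yo yind]] := greedy_socle; exists y; split=> // c a cm i.
have [ci|/(nth_default 0) ->] := ltnP i (size c); last exact: dvdz0.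
pose n := size c.
have descend t : (forall i, (i < n)%N -> ((p ^ (k i).+1)%N %| c`_i * (p ^ t)%N)%Z) ->
    forall i, (i < n)%N -> ((p ^ (k i).+1)%N %| c`_i)%Z.
  elim: t => [|t IH] ht; first by move=> j /ht; rewrite expn0 mulr1.
  apply: IH.
  have /choice [d dP] : forall j, exists d : int, (j < n)%N ->
      c`_j * (p ^ t)%N = d * (p ^ k j)%N.
    move=> j; have [jn|_] := boolP (j < n)%N; last by exists 0.
    have := ht j jn; rewrite !expnSr !PoszM mulrA dvdz_mul2r //.
    by move=> /dvdzP [q ->]; exists q.
  move=> j jn; rewrite dP // expnSr PoszM.
  rewrite [d j * _]mulrC dvdz_mul2l; last by rewrite -lt0n expn_gt0 prime_gt0.
  apply: (yind n d) => //.
  split; last exists (a *~ (p ^ t)%N).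
    rewrite -sumrMnl big1 // => i0 _.
    by rewrite [LHS]pmulrn mulrzAC -[_ *~ p]pmulrn -mulrnA -expnSr yo mul0rz.
  transitivity (lincomb y c *~ (p ^ t)%N); last by rewrite cm !pmulrn -!mulrzA mulrC.
  rewrite /lincomb mulrz_suml; apply: eq_bigr => i0 _.
  by rewrite pmulrn -!mulrzA dP // mulrC.
apply: (descend (\sum_(j < n) (k j).+1)%N) => // j jn.
apply/dvdz_mull; rewrite dvdzE /=; apply: dvdn_exp2l.
by rewrite (bigD1 (Ordinal jn)) //= leq_addr.
Qed.

End Greedy.

(** Finite [p]-torsion makes the p^n-torsion finite for every [n], while the
    primary component is infinite, so the [p]-torsion of p^n A is never zero; by
    compactness some nonzero element of order [p] lies in all p^n A.
    Compactness also shows that the subgroup [D] of [p]-power torsion elements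
    of infinite [p]-height is divisible.  The identity of [D] extends to A, and
    its [p]-th multiple is surjective on [D] but kills an element. *)
Lemma finite_socle_not_Bassian (y : nat -> A) :
  p_power_torsion_seq p y -> finite_pred (fun z : A => z *+ p = 0) -> ~ Bassian A.
Proof.
move=> [yinj yp] [s sP].
have fin n : finite_pred (fun z : A => z *+ p ^ n = 0).
  elim: n => [|n [t tP]]; first by exists [:: 0] => z; rewrite mulr1n => ->; rewrite inE.
  have /choice [g gP] : forall w, exists z : A, (exists z', z' *+ p = w) -> z *+ p = w.
    move=> w; have [[z zw]|no] := pselect (exists z' : A, z' *+ p = w); first by exists z.
    by exists 0 => /no.
  exists [seq g w + z | w <- t, z <- s] => z zn.
  apply/allpairsP; exists (z *+ p, z - g (z *+ p)); split => /=.
  - by apply: tP; rewrite -mulrnA -expnS.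
  - by apply: sP; rewrite mulrnBl gP ?subrr //; exists z.
  - by rewrite addrC subrK.
have socle n : exists2 z, z \in s & p_socle_of_multiples (p ^ n) z /\ z <> 0.
  have [i yi] : exists i, y i *+ p ^ n <> 0.
    apply: contrapT => none; apply: (injective_infinite yinj _ (fin n)) => i.
    by apply: contrapT => yi; apply: none; exists i.
  have [l yl] := yp i.
  have [|j [zj zjp]] := @socle_multiple _ p l _ yi; first by rewrite mulrnAC yl mul0rn.
  exists (y i *+ p ^ n *+ p ^ j); first exact: sP.
  by split=> //; split=> //; exists (y i *+ p ^ j); rewrite mulrnAC.
have [|z0 _ z0P] := finite_decreasing
    (Q := fun n z => p_socle_of_multiples (p ^ n) z /\ z <> 0) _ socle.
  move=> n z [[zp [a za]] zN0]; split=> //; split=> //.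
  by exists (a *+ p); rewrite za -mulrnA -expnS.
pose D x := primary_component p x /\ forall n, exists a : A, x = a *+ p ^ n.
have D0 : D 0 by split=> [|n]; [exists 0%N; rewrite mul0rn|exists 0; rewrite mul0rn].
have DB u v : D u -> D v -> D (u - v).
  move=> [[k uk] Du] [[l vl] Dv]; split=> [|n]; last first.
    by have [[a ->] [b ->]] := (Du n, Dv n); exists (a - b); rewrite mulrnBl.
  by exists (k + l)%N; rewrite expnD mulrnBl mulrnA uk mul0rn mulnC mulrnA vl mul0rn subrr.
pose DG := prop_subgroup D0 DB.
have Ddiv u : D u -> exists2 v, D v & v *+ p = u.
  move=> [[k uk] Du]; have [v0 uv0] := Du 1%N.
  have [//|n|v _ vP] := finite_decreasing (s := [seq v0 + z | z <- s])
    (Q := fun n v => v *+ p = u /\ exists a, v = a *+ p ^ n).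
  - by move=> n v [vu [a va]]; split=> //; exists (a *+ p); rewrite va -mulrnA -expnS.
  - have [a ua] := Du n.+1; exists (a *+ p ^ n); last first.
      by rewrite -mulrnA -expnSr -ua; split=> //; exists a.
    apply/mapP; exists (a *+ p ^ n - v0); last by rewrite addrC subrK.
    by apply: sP; rewrite mulrnBl -mulrnA -expnSr -ua uv0 expn1 subrr.
  have vu : v *+ p = u by have [] := vP 0%N.
  exists v => //; split=> [|n]; last by have [] := vP n.
  by exists k.+1; rewrite expnS mulrnA vu.
have DG_div : divisible (subgroup DG).
  move=> q l pq; have /prop_subgroupP Dl := valP l.
  have [<-|/eqP qp] := eqVneq p q.
    have [v Dv vl] := Ddiv _ Dl.
    exists (to_subgroup (introT (prop_subgroupP D0 DB v) Dv)); apply: val_inj.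
    by rewrite raddfMn; exact: vl.
  have [|v vl] := @not_dvd_primary _ p q l pp pq _ (nesym qp); last by exists (l *~ v).
  by case: Dl => [[k lk] _]; exists k; apply: val_inj; rewrite raddfMn.
pose R0 : set (A * subgroup DG) := fun u => u.1 = val u.2.
have R0g : additive_graph R0.
  split; first by [].
  - by move=> [a l] [b l']; rewrite /R0 /= => -> ->.
  - by move=> l; rewrite /R0 /= => l0; apply: val_inj; exact: esym l0.
have [|h hR] := graph_extension R0g; first by move=> *; exact: DG_div.
have h_val (l : subgroup DG) : h (val l) = l by apply: hR.
have phB : zmod_morphism (fun a => h a *+ p) by move=> a b; rewrite raddfB mulrnBl.
apply: (@not_Bassian A _ DG h (additive_of phB)).
- move=> x Dx; rewrite -(val_to_subgroup Dx) h_val => ->.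
  exact: raddf0.
- move=> a; have [z za] := DG_div p (h a - h a *+ p) pp.
  by exists (val z); rewrite ?(valP z) //= h_val.
- have [[z0p _] z0N] := z0P 0%N; exists z0; split=> //.
    apply/prop_subgroupP; split; first by exists 1%N; rewrite expn1.
    by move=> n; have [[]] := z0P n.
  by rewrite /= -raddfMn z0p raddf0.
Qed.

Lemma infinite_primary_not_Bassian (y : nat -> A) :
  p_power_torsion_seq p y -> ~ Bassian A.
Proof.
move=> yP.
(* The last premise says that the orders of the greedy family suffice to cover
   the m-torsion of the target: they grow without bound when m = 0, and they
   are all equal to m otherwise. *)
have by_greedy m (k : nat -> nat) : finite_pred (p_socle_of_multiples m) ->
    (forall i, ~ finite_pred (p_socle_of_multiples (p ^ k i))) ->
    (forall l : prufer_sum p, l *+ m = 0 ->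
     exists M, forall i, (M <= i)%N -> l *+ p ^ (k i).+1 = 0) -> ~ Bassian A.
  move=> fin_m inf_k mk; have [x [xo xind]] := greedy_family fin_m inf_k.
  exact: (family_prufer_not_Bassian pp xo xind mk).
have [inf|] := pselect (forall n, ~ finite_pred (p_socle_of_multiples (p ^ n))).
  apply: (by_greedy 0%N id) => // [|l _].
    by exists [:: 0] => z [_ [a ->]]; rewrite mulr0n inE.
  have [M lM] := prufer_sum_torsion pp l; exists M => i Mi.
  by rewrite -(subnKC (leqW Mi)) expnD mulrnA lM mul0rn.
move=> /existsNP [n /contrapT finn].
elim: n finn => [|n IH] finn.
  apply: (finite_socle_not_Bassian yP); have [s sP] := finn.
  by exists s => z zp; apply: sP; split=> //; exists z.
have [/IH//|infn] := pselect (finite_pred (p_socle_of_multiples (p ^ n))).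
by apply: (by_greedy (p ^ n.+1)%N (fun=> n)) => // l ln; exists 0%N.
Qed.

End PrimaryPart.

(** * Subgroups of Bassian groups and of sums with elementary groups *)

Lemma Bassian_inj (A B : zmodType) (j : {additive B -> A}) :
  injective j -> Bassian A -> Bassian B.
Proof.
move=> jinj BA N [f finj] x Nx; apply: contrapT => x0.
have [[y yind]|[p [y [pp [yinj yp]]]]] := lift_dichotomy finj Nx x0.
  apply: (@infinite_rank_not_Bassian A (j \o y) _ BA) => c.
  by rewrite -lincomb_comp -[RHS](raddf0 j) => /jinj /yind.
apply: (infinite_primary_not_Bassian pp (y := j \o y) _ BA).
split; first exact: inj_comp.
by move=> i; have [k yk] := yp i; exists k; rewrite /= -raddfMn yk raddf0.
Qed.

(** The map that is [0] on [A] and the identity on [E1] extends to G although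
    [E1] need not be divisible: when [a + e] is to be adjoined and [l] is the
    value at its [p]-th multiple, [l] is also the value at [e *+ p], whose order
    is prime to [p] because [E] is elementary; hence so is the order of [l],
    and [p] acts invertibly on [l]. *)
Lemma elementary_retraction (G : zmodType) (A E E1 : zmodClosed G) :
  internal_direct_sum A E -> elementary (subgroup E) -> {subset E1 <= E} ->
  exists r : {additive G -> subgroup E1},
    (forall a, a \in A -> r a = 0) /\ forall e : subgroup E1, r (val e) = e.
Proof.
move=> [GAE AE0] [Etors Eelem] E1E.
pose R0 : set (G * subgroup E1) := fun u => u.1 - val u.2 \in A.
have R0g : additive_graph R0.
  split; first by rewrite /R0 /= subrr rpred0.
  - move=> [x l] [y l']; rewrite /R0 /= => hx hy.
    by rewrite subrACA rpredB.
  - move=> l; rewrite /R0 /= sub0r rpredN => lA; apply: val_inj.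
    by rewrite [RHS]raddf0; apply: AE0 => //; apply/E1E/valP.
have [|r rR] := graph_extension R0g; last first.
  exists r; split=> [a aA|e]; apply: rR; rewrite /R0 /=; last by rewrite subrr rpred0.
  by rewrite subr0.
move=> R Rg R0R p x l pp; have [a [e [aA eE ->]]] := GAE x => hR.
have Rl : R (e *+ p, l).
  have /(graphB Rg hR) : R (a *+ p, 0).
    by apply: R0R; rewrite /R0 /= subr0 rpredMn.
  by rewrite mulrnDl addrAC subrr add0r subr0.
pose e' := to_subgroup eE.
have [n [n0 en]] := Etors e'.
have [b [u [nu up]]] := primary_split pp n0.
have /(Eelem p pp) eup : primary_component p (e' *+ u).
  by exists b; rewrite -mulrnA -nu.
have lu : l *+ u = 0.
  apply: (graph_fun Rg (graphMn Rg u Rl)).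
  have eup0 : e *+ u *+ p = 0 by have := congr1 val eup; rewrite !raddfMn.
  by rewrite mulrnAC eup0; exact: graph0.
have [|v vl] := @mulrz_coprime_inv _ u p l _ lu; first by rewrite coprime_sym.
by exists (l *~ v).
Qed.

Lemma direct_sum_projection (G : zmodType) (A E : zmodClosed G) :
  internal_direct_sum A E ->
  exists q : {additive G -> subgroup A}, forall g, g - val (q g) \in E.
Proof.
move=> [GAE AE0].
have /choice [q qE] : forall g, exists a : subgroup A, g - val a \in E.
  move=> g; have [a [e [aA eE ->]]] := GAE g.
  by exists (to_subgroup aA); rewrite val_to_subgroup addrAC subrr add0r.
have qB : zmod_morphism q.
  move=> x y; apply: val_inj; apply/eqP; rewrite -subr_eq0; apply/eqP/AE0.
    by apply: rpredB; apply: valP.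
  have -> : val (q (x - y)) - val (q x - q y) =
      (x - val (q x)) - (y - val (q y)) - (x - y - val (q (x - y))).
    by rewrite (subrACA x) (subrACA (x - y)) subrr sub0r opprB.
  by apply: rpredB => //; apply: rpredB.
by exists (additive_of qB).
Qed.

Lemma elementary_inj (E B : zmodType) (j : {additive B -> E}) :
  injective j -> elementary E -> elementary B.
Proof.
move=> jinj [Etors Eelem]; split=> [x|p pp x [k xk]].
  have [n [n0 xn]] := Etors (j x); exists n; split=> //.
  by apply: jinj; rewrite raddfMn xn raddf0.
apply: jinj; rewrite raddfMn raddf0; apply: Eelem => //.
by exists k; rewrite -raddfMn xk raddf0.
Qed.

Theorem corollary3p4 (G : zmodType) (H : zmodClosed G) :
  BplusE_group G -> BplusE_group (subgroup H).
Proof.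
move=> [A [E [GAE BA EE]]].
have PI0 : (0 : G) \in H /\ (0 : G) \in E by rewrite !rpred0.
have PIB x y : x \in H /\ x \in E -> y \in H /\ y \in E ->
    x - y \in H /\ x - y \in E.
  by move=> [xH xE] [yH yE]; rewrite !rpredB.
pose HE := prop_subgroup PI0 PIB.
have [|r [rA rE]] := @elementary_retraction G A E HE GAE EE.
  by move=> x /prop_subgroupP [].
have A1_0 : r (val (0 : subgroup H)) = 0 by rewrite !raddf0.
have A1_B (x y : subgroup H) : r (val x) = 0 -> r (val y) = 0 -> r (val (x - y)) = 0.
  by move=> hx hy; rewrite !raddfB /= hx hy subrr.
have E1_0 : val (0 : subgroup H) \in E by rewrite raddf0 rpred0.
have E1_B (x y : subgroup H) : val x \in E -> val y \in E -> val (x - y) \in E.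
  by move=> hx hy; rewrite raddfB rpredB.
set A1 := prop_subgroup A1_0 A1_B; set E1 := prop_subgroup E1_0 E1_B.
have A1E1 (x : subgroup H) : r (val x) = 0 -> val x \in E -> x = 0.
  move=> rx xE; have xHE : val x \in HE by apply/prop_subgroupP; split=> //; apply: valP.
  apply: val_inj; have := rE (to_subgroup xHE); rewrite [LHS]rx.
  by move=> /(congr1 val) /esym.
exists A1, E1; split.
- split=> x; last by move=> /prop_subgroupP rx /prop_subgroupP; apply: A1E1.
  have /prop_subgroupP [eH eE] := valP (r (val x)).
  exists (x - to_subgroup eH), (to_subgroup eH); rewrite subrK; split=> //.
    by apply/prop_subgroupP; rewrite !raddfB /= rE subrr.
  exact/prop_subgroupP.
- have [q qE] := direct_sum_projection GAE.
  pose j (x : subgroup A1) := q (val (val x)).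
  have jB : zmod_morphism j by move=> x y; rewrite /j !raddfB.
  apply: (@Bassian_inj _ _ (additive_of jB)) BA.
  apply: raddf_inj => x jx; apply: val_inj; apply: A1E1.
    exact: elimT (prop_subgroupP A1_0 A1_B _) (valP x).
  by have := qE (val (val x)); rewrite [q _]jx subr0.
- pose j (x : subgroup E1) := to_subgroup (elimT (prop_subgroupP E1_0 E1_B _) (valP x)).
  have jB : zmod_morphism j by move=> x y; apply: val_inj.
  apply: (@elementary_inj _ _ (additive_of jB)) EE.
  by move=> x y xy; do 2![apply: val_inj]; exact: (congr1 (fun z : subgroup E => val z) xy).
Qed.
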